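(* Let $I\subseteq\mathbb{R}$ be an interval and let $f:I\to\mathbb{R}$ be such that $f'':I\to\mathbb{R}$ is an absolutely continuous function on the interior $I^{\circ}$ and $f'''\in L[a,b]$, where $a,b\in I$, $a<b$. Let $q>1$ and let $p$ satisfy $\frac{1}{p}+\frac{1}{q}=1$. If $|f'''|^{q}$ belongs to $Q(I)$, then $$\left|\frac{f(a)+f(b)}{2}-\frac{1}{b-a}\int_{a}^{b}f(x)\,dx-\frac{b-a}{12}\left[f'(b)-f'(a)\right]\right|\leq \frac{(b-a)^{3}}{12}\,\frac{\left(\beta(q,q+1)\right)^{\frac{1}{q}}}{(p+1)^{\frac{1}{p}}}\left[|f'''(a)|^{q}+|f'''(b)|^{q}\right]^{\frac{1}{q}}.$$
   Context: Godunova-Levin class: a map $g:I\to\mathbb{R}$ is said to belong to the class $Q(I)$ if it is nonnegative and for all $x,y\in I$ and $\lambda\in(0,1)$ it satisfies $g(\lambda x+(1-\lambda)y)\leq \frac{g(x)}{\lambda}+\frac{g(y)}{1-\lambda}$. $L[a,b]$ denotes the space of Lebesgue integrable functions on $[a,b]$. $\beta(\cdot,\cdot)$ is the Euler Beta function, $\beta(x,y)=\int_{0}^{1}t^{x-1}(1-t)^{y-1}\,dt$ for $x,y>0$. *)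

(* Defs.v *)
From HB Require Import structures.
From mathcomp Require Import all_boot all_order all_algebra.
From mathcomp Require Import all_classical all_reals all_analysis.
Set Implicit Arguments.
Unset Strict Implicit.
Unset Printing Implicit Defensive.
Import Order.TTheory GRing.Theory Num.Theory.
Import numFieldNormedType.Exports.
Local Open Scope classical_set_scope.
Local Open Scope ring_scope.

(* Functions on an interval I are total functions R -> R of which only the
   values on I matter. *)

(* l is the derivative at x of the restriction of f to I: it is the usual
   derivative at an interior point of I, and a one-sided derivative at an
   endpoint of I belonging to I. *)
Definition has_derivative_in (R : realType) (I : set R) (f : R -> R)
    (x l : R) : Prop :=
  (f y - f x) / (y - x) @[y --> within I x^'] --> l.

Definition absolutely_continuous_on (R : realType) (J : set R) (g : R -> R) :
    Prop :=
  forall e : R, 0 < e -> exists2 d : R, 0 < d &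
    forall (n : nat) (u v : 'I_n -> R),
      (forall i, [/\ J (u i), J (v i) & u i <= v i]) ->
      trivIset [set: 'I_n] (fun i => [set` `]u i, v i[]) ->
      \sum_(i < n) (v i - u i) < d ->
      \sum_(i < n) `|g (v i) - g (u i)| < e.

(* On an open, possibly unbounded, interval J, absolute continuity is understood
   on every compact subinterval. *)
Definition locally_absolutely_continuous_on (R : realType) (J : set R)
    (g : R -> R) : Prop :=
  forall c d : R, c <= d -> [set` `[c, d]] `<=` J ->
    absolutely_continuous_on [set` `[c, d]] g.

Definition godunova_levin (R : realType) (I : set R) (g : R -> R) : Prop :=
  (forall x, I x -> 0 <= g x) /\
  (forall x y t : R, I x -> I y -> 0 < t < 1 ->
    g (t * x + (1 - t) * y) <= g x / t + g y / (1 - t)).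

(* L[a, b]; the measure is the completed one, so that f only has to be
   Lebesgue measurable on [a, b] and not Borel measurable. *)
Definition lebesgue_integrable (R : realType) (a b : R) (f : R -> R) : Prop :=
  (@completed_lebesgue_measure R).-integrable [set` `[a, b]] (EFin \o f).

(* Meaningful for x, y > 0. The library's beta_fun only has natural arguments. *)
Definition euler_beta (R : realType) (x y : R) : R :=
  \int[@lebesgue_measure R]_(t in [set` `[0%R, 1%R]])
    (t `^ (x - 1) * (1 - t) `^ (y - 1)).

(* Main.v *)
(* Put m = (a + b) / 2, h = (b - a) / 2 and write g(m +- s) for
   g(m + s) + g(m - s). The function
     Z(s) = s f(m +- s) - int_(m - s)^(m + s) f
            + (h^2 - 3 s^2) / 6 (f'(m + s) - f'(m - s))
            - (h^2 - s^2) s / 6 f''(m +- s)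
   satisfies Z(0) = 0, Z(h) is b - a times the quantity to be bounded, and
   Z'(s) = - (h^2 - s^2) s / 6 (f'''(m + s) - f'''(m - s)) almost everywhere.
   The Godunova-Levin inequality bounds |f'''| on ]a, b[ by a continuous function
   G. An absolutely continuous function whose derivative is almost everywhere at
   most M in absolute value is M-Lipschitz, so the growth rate of f'' is at most G
   at every point of ]a, b[, without exceptional set. Comparing Z with an explicit
   primitive V then gives the theorem; V comes from applying Young's inequality
   pointwise to (s / h) * (t (1 - t) G), t = (h - s) / (2 h), with the weights
   optimal for Hoelder's inequality, so that only the integrals of s^p and of
   t^(q - 1) (1 - t)^q appear. *)
Require Import Defs.
From HB Require Import structures.
From mathcomp Require Import all_boot all_order all_algebra.
From mathcomp Require Import all_classical all_reals all_analysis.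
From mathcomp Require Import measurable_realfun ring lra.
Import Order.TTheory GRing.Theory Num.Theory.
Import numFieldNormedType.Exports.
Local Open Scope classical_set_scope.
Local Open Scope ring_scope.
Set Implicit Arguments.
Unset Strict Implicit.
Unset Printing Implicit Defensive.

(** * Real induction and the mean value inequality for growth rates *)

(** The supremum s of the points satisfying [S] is reached and passed by one step from some x just
    left of s to some y just right of it. As in Cousin's lemma, a step only has to straddle its tag
    s. *)
Lemma interval_induction (R : realType) (c d : R) (S : R -> Prop) :
  c <= d -> S c ->
  (forall s, c <= s <= d -> exists2 e, 0 < e &
     forall x y, c <= x -> x <= s -> s <= y -> y <= d -> s - e < x -> y < s + e ->
       S x -> S y) ->
  S d.
Proof.
move=> cd Sc step; pose A := [set x | c <= x <= d /\ S x].
have Ac : A c by split=> //; rewrite lexx.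
have Aub : ubound A d by move=> x [/andP[_ ->]].
have hA : has_sup A by split; [exists c | exists d].
have cs : c <= sup A by exact: ub_le_sup (proj2 hA) _ Ac.
have sd : sup A <= d by apply: ge_sup Aub; exists c.
have [|e e0 He] := step (sup A); first by rewrite cs sd.
have [x [/andP[cx xd] Sx] sx] := sup_adherent e0 hA.
have xs : x <= sup A by apply: (ub_le_sup (proj2 hA)); split; [apply/andP|].
have [sdlt|] := ltP (sup A) d; last first.
  by move=> ds; apply: (He x d) => //; apply: le_lt_trans ds _; rewrite ltrDl.
pose y := Num.min d (sup A + e / 2).
have sy : sup A < y by rewrite /y lt_min sdlt ltrDl divr_gt0.
have yd : y <= d by rewrite /y ge_min lexx.
have ye : y < sup A + e.
  by rewrite /y gt_min ltrD2l ltr_pdivrMr// ltr_pMr// ltr1n orbT.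
have Sy : S y by apply: (He x y) => //; exact: ltW.
have : y <= sup A.
  apply: (ub_le_sup (proj2 hA)); split=> //; rewrite yd andbT.
  exact: le_trans cs (ltW sy).
by rewrite leNgt sy.
Qed.

(** The upper limit of |f y - f x| / |y - x| at x is at most L; differentiability is not assumed. *)
Definition slope_le (R : realType) (f : R -> R) (x L : R) : Prop :=
  forall e, 0 < e -> \forall y \near x, `|f y - f x| <= (L + e) * `|y - x|.

Lemma is_derive_slope (R : realType) (f : R -> R) (x l : R) :
  is_derive x 1 f l ->
  forall e, 0 < e -> \forall y \near x, `|f y - f x - l * (y - x)| <= e * `|y - x|.
Proof.
move=> [df dv] e e0.
have := df; rewrite /derivable => /cvg_ex[l' cl].
have El : l' = l by rewrite -dv /derive; apply/esym/cvg_lim.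
rewrite El in cl.
move/cvgrPdist_le : cl => /(_ e e0).
rewrite /dnbhs => -[d /= d0 Hd].
exists d => // y /= yd.
have [->|yx] := eqVneq y x; first by rewrite !subrr mulr0 subrr normr0 mulr0.
have := Hd (y - x); rewrite /= sub0r normrN => /(_ _ _).
rewrite distrC in yd; move=> /(_ yd); rewrite subr_eq0 => /(_ yx).
rewrite /= [_ *: 1]mulr1 subrK => Hy.
have yx0 : 0 < `|y - x| by rewrite normr_gt0 subr_eq0.
rewrite -ler_pdivrMr// -normfV -normrM.
rewrite (_ : _ / _ = - (l - (y - x)^-1 *: (f y - f x))) ?normrN//.
by rewrite -[_ *: _]/(_ * _); field; rewrite subr_eq0.
Qed.

Lemma is_derive_slope_le (R : realType) (f : R -> R) (x l : R) :
  is_derive x 1 f l -> slope_le f x `|l|.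
Proof.
move=> /is_derive_slope df e e0; near=> y.
have : `|f y - f x - l * (y - x)| <= e * `|y - x| by near: y; exact: df.
have := ler_normD (f y - f x - l * (y - x)) (l * (y - x)).
rewrite subrK normrM; lra.
Unshelve. all: by end_near. Qed.

(** Near a tag s, Z grows at rate at most w s + e/2 and V at rate at least w s - e/2. On a step
    straddling s the two distances to s add up to y - x, so the defect is at most e (y - x). *)
Lemma slope_le_increment (R : realType) (Z V w : R -> R) (c d : R) :
  c <= d ->
  (forall s, c <= s <= d -> slope_le Z s (w s)) ->
  (forall s, c <= s <= d -> is_derive s 1 V (w s)) ->
  `|Z d - Z c| <= V d - V c.
Proof.
move=> cd HZ HV.
suff H e : 0 < e -> `|Z d - Z c| <= V d - V c + e * (d - c).
  apply/ler_addgt0Pr => e e0.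
  (* The added 1 keeps the divisor positive when c = d. *)
  have dc1 : 0 < d - c + 1 by rewrite ltr_wpDl// subr_ge0.
  apply: (le_trans (H (e / (d - c + 1)) _)); first by rewrite divr_gt0.
  rewrite lerD2l -mulrA ler_piMr ?(ltW e0)// mulrC ler_pdivrMr// mul1r.
  by rewrite lerDl.
move=> e0.
apply: (@interval_induction _ c d
  (fun x => `|Z x - Z c| <= V x - V c + e * (x - c))) => //.
  by rewrite !subrr normr0 mulr0 addr0.
move=> s scd.
have e20 : 0 < e / 2 by rewrite divr_gt0.
have := HZ s scd _ e20; have := is_derive_slope (HV s scd) e20 => /= HV' HZ'.
have [r /= r0 Hr] : \forall y \near s, `|Z y - Z s| <= (w s + e / 2) * `|y - s| /\
   `|V y - V s - w s * (y - s)| <= e / 2 * `|y - s|.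
  by near=> y; split; near: y.
exists r => // x y cx xs sy yd rx ry.
have [] : `|Z x - Z s| <= (w s + e / 2) * `|x - s| /\
    `|V x - V s - w s * (x - s)| <= e / 2 * `|x - s|.
  by apply: Hr; rewrite /= ger0_norm ?subr_ge0// ltrBlDr addrC -ltrBlDr.
have [] : `|Z y - Z s| <= (w s + e / 2) * `|y - s| /\
    `|V y - V s - w s * (y - s)| <= e / 2 * `|y - s|.
  by apply: Hr; rewrite /= distrC ger0_norm ?subr_ge0// ltrBlDr addrC.
have ys0 : `|y - s| = y - s by rewrite ger0_norm ?subr_ge0.
have xs0 : `|x - s| = s - x by rewrite distrC ger0_norm ?subr_ge0.
rewrite ys0 xs0 !ler_norml.
move=> /andP[? ?] /andP[? ?] /andP[? ?] /andP[? ?] /andP[? ?].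
by apply/andP; split; nra.
Unshelve. all: by end_near. Qed.

(** * Increments of absolutely continuous functions *)

Lemma negligible_open_cover (R : realType) (N : set R) (e : R) :
  (@lebesgue_measure R).-negligible N -> 0 < e ->
  exists U, [/\ open U, N `<=` U & (@lebesgue_measure R U < e%:E)%E].
Proof.
move=> [D [mD D0 ND]] e0.
have [|U [oU DU Ue]] := lebesgue_regularity_outer mD _ e0.
  by rewrite -[X in (X < _)%E]/(@lebesgue_measure R D) D0 ltry.
exists U; split=> //; first exact: subset_trans ND DU.
rewrite -(setDUK DU); apply: le_lt_trans Ue.
have mU : measurable U by exact: open_measurable.
rewrite measureU//; [|exact: measurableD|by rewrite setDIK].
by rewrite -[X in (X + _)%E]/(@lebesgue_measure R D) D0 add0e.
Qed.

(** The lengths of ordered intervals add up to the measure of their union. This puts the steps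
    collected inside a small open set in the form that absolute continuity requires. *)
Lemma sum_disjoint_itv_le (R : realType) (U : set R) (n : nat) (u v : nat -> R) :
  measurable U ->
  (forall i, (i < n)%N -> u i <= v i /\ `]u i, v i[ `<=` U) ->
  (forall i j, (i < j < n)%N -> v i <= u j) ->
  trivIset [set: 'I_n] (fun i : 'I_n => [set` `]u i, v i[]) /\
  ((\sum_(i < n) (v i - u i))%:E <= @lebesgue_measure R U)%E.
Proof.
move=> mU uv ord.
have tI : trivIset [set: 'I_n] (fun i : 'I_n => [set` `]u i, v i[]).
  have disj (i j : 'I_n) t : (i < j)%N -> t \in `]u i, v i[ -> t \in `]u j, v j[ ->
      False.
    rewrite !in_itv/= => ij /andP[_ tv] /andP[ut _].
    have := ord i j; rewrite ij ltn_ord => /(_ isT) vu.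
    by have := lt_trans ut tv; rewrite ltNge vu.
  move=> i j _ _ [t [/= ti tj]]; apply/val_inj.
  case: (ltngtP i j) => // ij; exfalso; [exact: disj ti tj|exact: disj tj ti].
split=> //.
have -> : (\sum_(i < n) (v i - u i))%:E =
    lebesgue_measure (\big[setU/set0]_(i < n) [set` `]u i, v i[]).
  rewrite -sumEFin measure_bigsetU_ord//.
  apply: eq_bigr => i _; have [uvi _] := uv i (ltn_ord i).
  transitivity (@lebesgue_measure R `]u i, v i[) => //.
  rewrite lebesgue_measure_itv/= lte_fin; case: ltP => //.
  by move=> vu; have -> : u i = v i by [apply/le_anti; rewrite uvi vu]; rewrite subrr.
apply: le_measure; rewrite ?inE//.
  by apply: bigsetU_measurable => i _; exact: measurable_itv.
rewrite -(bigcup_mkord n (fun i => [set` `]u i, v i[])) => t [i /= ni].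
by have [_] := uv i ni; exact.
Qed.

Lemma ac_increment (R : realType) (g : R -> R) (c d M : R) :
  c <= d -> 0 <= M -> absolutely_continuous_on [set` `[c, d]] g ->
  {ae @lebesgue_measure R, forall x, c <= x <= d -> slope_le g x M} ->
  `|g d - g c| <= M * (d - c).
Proof.
move=> cd M0 gac gM.
(* Cousin-type argument: steps tagged at a point of the null set lie in an open
   set of small measure, where absolute continuity bounds their contribution. *)
suff H e : 0 < e -> `|g d - g c| <= (M + e) * (d - c) + e.
  apply/ler_addgt0Pr => e e0.
  have dc1 : 0 < d - c + 1 by rewrite ltr_wpDl// subr_ge0.
  apply: (le_trans (H (e / (d - c + 1)) _)); first by rewrite divr_gt0.
  by rewrite mulrDl -addrA lerD2l -[X in _ + X]mulr1 -mulrDr divfK ?gt_eqF.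
move=> e0; have [del del0 Hdel] := gac _ e0.
have [U [oU NU Udel]] := negligible_open_cover gM del0.
(* The listed intervals are the steps tagged in [U]; the final sum records their increments, while
   the rate M + e pays for all other steps. *)
pose S x := exists n (u v : nat -> R),
  [/\ forall i, (i < n)%N -> [/\ c <= u i, u i <= v i, v i <= x & `]u i, v i[ `<=` U],
      forall i j, (i < j < n)%N -> v i <= u j &
      `|g x - g c| <= (M + e) * (x - c) + \sum_(i < n) `|g (v i) - g (u i)|].
have [n [u [v [uv ord gdc]]]] : S d.
  apply: (interval_induction cd).
    exists 0%N, (fun=> c), (fun=> c); split=> //.
    by rewrite big_ord0 !subrr normr0 mulr0 addr0.
  move=> s scd; have [sU|sU] := pselect (U s).
    have [r /= r0 Hr] := oU _ sU.
    exists r => // x y cx xs sy yd rx ry [n [u [v [uv ord gxc]]]].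
    (* The step from x to y is appended as the last interval; it stays within r of s, hence inside
       [U]. *)
    exists n.+1, (fun i => if (i < n)%N then u i else x),
                 (fun i => if (i < n)%N then v i else y); split.
    - move=> i _; case: ifPn => [/uv[? ? vx ?]|_]; split=> //.
      + by rewrite (le_trans vx)// (le_trans xs).
      + exact: le_trans xs sy.
      + move=> t /=; rewrite in_itv/= => /andP[xt ty]; apply: Hr.
        by rewrite /ball/= ltr_norml; apply/andP; split; lra.
    - move=> i j /andP[ij]; rewrite ltnS leq_eqVlt => /predU1P[jn|jn].
        rewrite jn ltnn -jn ij; case: (uv i) => //; first by rewrite -jn.
      by rewrite (ltn_trans ij jn) jn ord// ij.
    - rewrite big_ord_recr/= ltnn.
      under eq_bigr do rewrite ltn_ord.
      have := ler_normD (g y - g x) (g x - g c); rewrite addrA subrK.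
      have : (M + e) * (x - c) <= (M + e) * (y - c).
        by rewrite ler_wpM2l ?addr_ge0 ?(ltW e0)// lerD2r (le_trans xs).
      lra.
  have slope : slope_le g s M.
    (* [U] contains every point where the slope bound fails, so the bound holds at s by
       contraposition. *)
    have : ~ ~ (c <= s <= d -> slope_le g s M) by move=> H; apply/sU/NU.
    by move=> /contrapT; exact.
  have [r /= r0 Hr] := slope _ e0.
  exists r => // x y cx xs sy yd rx ry [n [u [v [uv ord gxc]]]].
  exists n, u, v; split=> //.
    by move=> i /uv[? ? vx ?]; split=> //; rewrite (le_trans vx)// (le_trans xs).
  have : `|g x - g s| <= (M + e) * `|x - s|.
    by apply: Hr; rewrite /= ger0_norm ?subr_ge0// ltrBlDr addrC -ltrBlDr.
  have : `|g y - g s| <= (M + e) * `|y - s|.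
    by apply: Hr; rewrite /= distrC ger0_norm ?subr_ge0// ltrBlDr addrC.
  have -> : `|y - s| = y - s by rewrite ger0_norm ?subr_ge0.
  have -> : `|x - s| = s - x by rewrite distrC ger0_norm ?subr_ge0.
  have := ler_normD (g y - g s) (g s - g x); rewrite addrA subrK (distrC (g s)).
  have := ler_normD (g y - g x) (g x - g c); rewrite addrA subrK.
  lra.
have [|trivI lenU] := sum_disjoint_itv_le (open_measurable oU) _ ord.
  by move=> i /uv[].
apply: (le_trans gdc); rewrite lerD2l; apply/ltW.
apply: (Hdel n (fun i => u i) (fun i => v i)) => //.
  move=> i; have [cu uvi vd _] := uv i (ltn_ord i); split=> //=; rewrite in_itv/=.
    by rewrite cu (le_trans uvi).
  by rewrite vd (le_trans cu).
by rewrite -lte_fin; exact: le_lt_trans lenU Udel.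
Qed.

(** * Derivatives relative to an interval, and the calculus of growth rates *)

Lemma slope_is_derive (R : realType) (f : R -> R) (x l : R) :
  (forall e, 0 < e -> \forall y \near x, `|f y - f x - l * (y - x)| <= e * `|y - x|) ->
  is_derive x 1 f l.
Proof.
move=> Hf; suff cl : (fun h => h^-1 *: (f (h *: 1 + x) - f x)) @ 0^' --> l.
  split; first by apply/cvg_ex; exists l.
  by apply/cvg_lim.
apply/cvgrPdist_le => e e0; have [d /= d0 Hd] := Hf e e0.
exists d => // h /=; rewrite sub0r normrN => hd h0.
have h1 : 0 < `|h| by rewrite normr_gt0.
have := Hd (h *: 1 + x); rewrite /= [h *: 1]mulr1 opprD addrCA subrr addr0 normrN.
move=> /(_ hd); rewrite addrK => H.
rewrite -(ler_pM2r h1) -normrM; apply: le_trans H.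
rewrite -[h^-1 *: _]/(h^-1 * _).
suff -> : (l - h^-1 * (f (h + x) - f x)) * h = - (f (h + x) - f x - l * h).
  by rewrite normrN.
by field.
Qed.

Lemma has_derivative_in_slope (R : realType) (I : set R) (f : R -> R) (x l : R) :
  has_derivative_in I f x l -> forall e, 0 < e ->
  \forall y \near x, I y -> `|f y - f x - l * (y - x)| <= e * `|y - x|.
Proof.
move=> /cvgrPdist_le Hf e e0; have [d /= d0 Hd] := Hf e e0.
exists d => // y /= yd Iy.
have [->|yx] := eqVneq y x; first by rewrite !subrr mulr0 subrr normr0 mulr0.
have yx0 : 0 < `|y - x| by rewrite normr_gt0 subr_eq0.
have := Hd y yd yx Iy; rewrite -(ler_pM2r yx0) -normrM.
suff -> : (l - (f y - f x) / (y - x)) * (y - x) = - (f y - f x - l * (y - x)).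
  by rewrite normrN.
by field; rewrite subr_eq0.
Qed.

Lemma has_derivative_in_is_derive (R : realType) (I : set R) (f : R -> R) (x l : R) :
  interior I x -> has_derivative_in I f x l -> is_derive x 1 f l.
Proof.
move=> Ix /has_derivative_in_slope Hf; apply: slope_is_derive => e /Hf He.
by near=> y; have : I y; [near: y|near: y].
Unshelve. all: by end_near. Qed.

Lemma has_derivative_in_continuous (R : realType) (I : set R) (f f' : R -> R)
    (a b : R) :
  `[a, b] `<=` I -> (forall x, I x -> has_derivative_in I f x (f' x)) ->
  {within `[a, b], continuous f}.
Proof.
move=> abI Hf; apply/subspace_continuousP => x xab.
have := has_derivative_in_slope (Hf x (abI _ xab)) ltr01 => H.
have c0 : 0 < `|f' x| + 1 by rewrite ltr_wpDl.
apply/cvgrPdist_le => e e0.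
have [r /= r0 Hr] := H.
exists (Num.min r (e / (`|f' x| + 1))); first by rewrite /= lt_min r0 divr_gt0.
move=> y /=; rewrite lt_min => /andP[yr ye] yab.
have := Hr y yr (abI _ yab); rewrite mul1r (distrC y) => H1.
have := ler_normD (f y - f x - f' x * (y - x)) (f' x * (y - x)).
rewrite subrK normrM (distrC y x) (distrC (f y)).
by move: ye; rewrite ltr_pdivlMr//; lra.
Qed.

Lemma slope_le_mono (R : realType) (f : R -> R) (x L M : R) :
  L <= M -> slope_le f x L -> slope_le f x M.
Proof.
move=> LM Hf e e0; near=> y.
apply: (@le_trans _ _ ((L + e) * `|y - x|)); first by near: y; exact: Hf.
by rewrite ler_wpM2r// lerD2r.
Unshelve. all: by end_near. Qed.

Lemma slope_le_shift (R : realType) (f : R -> R) (m s L : R) :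
  slope_le f (m + s) L -> slope_le (fun t => f (m + t)) s L.
Proof.
move=> Hf e /Hf[r /= r0 Hr]; exists r => // y /= ys.
have E u v : (m + u) - (m + v) = u - v :> R by ring.
by have := Hr (m + y); rewrite /= !E => /(_ ys).
Qed.

Lemma slope_le_reflect (R : realType) (f : R -> R) (m s L : R) :
  slope_le f (m - s) L -> slope_le (fun t => f (m - t)) s L.
Proof.
move=> Hf e /Hf[r /= r0 Hr]; exists r => // y /= ys.
have E u v : (m - u) - (m - v) = - (u - v) :> R by ring.
by have := Hr (m - y); rewrite /= !E !normrN => /(_ ys).
Qed.

Lemma slope_le_D (R : realType) (f g : R -> R) (x L M : R) :
  slope_le f x L -> slope_le g x M -> slope_le (fun t => f t + g t) x (L + M).
Proof.
move=> Hf Hg e e0; have e2 : 0 < e / 2 by rewrite divr_gt0.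
near=> y.
have : `|f y - f x| <= (L + e / 2) * `|y - x| by near: y; exact: Hf.
have : `|g y - g x| <= (M + e / 2) * `|y - x| by near: y; exact: Hg.
have := ler_normD (f y - f x) (g y - g x).
rewrite addrACA -opprD; lra.
Unshelve. all: by end_near. Qed.

(* The product rule when psi has only a bounded growth rate: the differentiable
   parts cancel to first order. *)
Lemma slope_le_cancel (R : realType) (D k psi : R -> R) (x d k' L : R) :
  0 <= L -> is_derive x 1 D d -> is_derive x 1 k k' -> slope_le psi x L ->
  d + k' * psi x = 0 -> slope_le (fun t => D t + k t * psi t) x (`|k x| * L).
Proof.
move=> L0 /is_derive_slope HD /is_derive_slope Hk Hpsi d0 e e0.
(* C collects the coefficients of eta |y - x| in the four error terms below, beyond the main term |k
   x| L |y - x|. *)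
pose C := 1 + `|psi x| + `|k x| + (`|k'| + 1) * (L + 1).
have C0 : 0 < C by rewrite /C; have := normr_ge0 (psi x); have := normr_ge0 (k x);
  have := mulr_ge0 (addr_ge0 (normr_ge0 k') ler01) (addr_ge0 L0 ler01); lra.
pose eta := Num.min 1 (e / C).
have eta0 : 0 < eta by rewrite lt_min ltr01 divr_gt0.
have eta1 : eta <= 1 by rewrite ge_min lexx.
have etaC : eta * C <= e by rewrite -ler_pdivlMr// ge_min lexx orbT.
near=> y.
have : `|D y - D x - d * (y - x)| <= eta * `|y - x| by near: y; exact: HD.
have : `|k y - k x - k' * (y - x)| <= eta * `|y - x| by near: y; exact: Hk.
have : `|psi y - psi x| <= (L + eta) * `|y - x| by near: y; exact: Hpsi.
have : `|y - x| <= eta.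
  by rewrite distrC; near: y; exists eta => //= z /ltW.
set dl := y - x; set a1 := D y - D x - _; set a2 := k y - k x - _.
set a3 := psi y - psi x => h h3 h2 h1.
have -> : D y + k y * psi y - (D x + k x * psi x) =
    a1 + psi x * a2 + k x * a3 + (a2 + k' * dl) * a3.
  (* The full expansion also contains the first-order term (d + k' psi x) dl, which is zero by
     hypothesis. *)
  transitivity (a1 + psi x * a2 + k x * a3 + (a2 + k' * dl) * a3
    + (d + k' * psi x) * dl); last by rewrite d0 mul0r addr0.
  rewrite /a1 /a2 /a3 /dl; ring.
have h2' : `|a2 + k' * dl| <= (1 + `|k'|) * eta.
  apply: (le_trans (ler_normD _ _)); rewrite normrM.
  by have := normr_ge0 k'; nra.
have h3' : `|a3| <= (L + 1) * `|dl| by have := normr_ge0 dl; nra.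
have h23 : `|a2 + k' * dl| * `|a3| <= ((1 + `|k'|) * eta) * ((L + 1) * `|dl|).
  exact: ler_pM.
apply: (le_trans (ler_normD _ _)); rewrite normrM.
apply: (le_trans (lerD (ler_normD _ _) (lexx _))); rewrite normrM.
apply: (le_trans (lerD (lerD (ler_normD _ _) (lexx _)) (lexx _))); rewrite normrM.
have p1 : `|psi x| * `|a2| <= `|psi x| * (eta * `|dl|) by rewrite ler_wpM2l.
have p2 : `|k x| * `|a3| <= `|k x| * ((L + eta) * `|dl|) by rewrite ler_wpM2l.
have p3 : eta * C * `|dl| <= e * `|dl| by rewrite ler_wpM2r.
rewrite /C in p3; nra.
Unshelve. all: by end_near. Qed.

(** By continuity, G is at most G x + e near x, so this constant bounds the slope of g almost
    everywhere there. [ac_increment] between x and y then bounds the increment from x itself, and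
    the null set disappears. *)
Lemma ac_slope_le (R : realType) (a b : R) (g G : R -> R) :
  locally_absolutely_continuous_on `]a, b[ g ->
  {ae @lebesgue_measure R, forall x, a < x < b -> slope_le g x (G x)} ->
  forall x, a < x < b -> 0 <= G x -> {for x, continuous G} -> slope_le g x (G x).
Proof.
move=> gac gG x xab G0 Gc e e0.
have xab' : x \in `]a, b[ by rewrite in_itv.
have Ge : \forall y \near x, a < y < b /\ G y <= G x + e.
  near=> y; split.
    suff : y \in `]a, b[ by rewrite in_itv.
    by near: y; exact: near_in_itvoo.
  have : `|G x - G y| <= e by near: y; move/cvgrPdist_le : Gc; exact.
  by rewrite ler_norml; lra.
have [r /= r0 Hr] := Ge.
have inc u v : u <= v -> `|x - u| < r -> `|x - v| < r ->
    `|g v - g u| <= (G x + e) * (v - u).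
  move=> uv ur vr.
  have uvr z : u <= z <= v -> `|x - z| < r.
    by move: ur vr; rewrite !ltr_norml; lra.
  apply: ac_increment => //.
  - by rewrite addr_ge0// ltW.
  - apply: gac => // z; rewrite /= in_itv/= => /uvr zr; rewrite in_itv/=.
    by have [] := Hr z zr.
  - apply: negligibleS gG => z /= Hz H; apply: Hz => /uvr zr; have [zab Gz] := Hr z zr.
    exact: slope_le_mono Gz (H zab).
exists r => // y /= yr; have xr : `|x - x| < r by rewrite subrr normr0.
have [xy|yx] := leP x y.
  by rewrite (@ger0_norm _ (y - x)) ?subr_ge0//; exact: inc.
rewrite distrC (distrC y) (@ger0_norm _ (x - y)) ?subr_ge0 ?(ltW yx)//.
by apply: inc => //; exact: ltW.
Unshelve. all: by end_near. Qed.

(** * The symmetric auxiliary function Z about the midpoint *)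

Lemma is_derive_shift_comp (R : realType) (f : R -> R) (m s l : R) :
  is_derive (m + s) 1 f l -> is_derive s 1 (fun t => f (m + t)) l.
Proof.
move=> /is_derive_slope Hf; apply: slope_is_derive => e /Hf[r /= r0 Hr].
exists r => // y /= ys.
have E u v : (m + u) - (m + v) = u - v :> R by ring.
by have := Hr (m + y); rewrite /= !E => /(_ ys).
Qed.

Lemma is_derive_reflect_comp (R : realType) (f : R -> R) (m s l : R) :
  is_derive (m - s) 1 f l -> is_derive s 1 (fun t => f (m - t)) (- l).
Proof.
move=> /is_derive_slope Hf; apply: slope_is_derive => e /Hf[r /= r0 Hr].
exists r => // y /= ys.
have E u v : (m - u) - (m - v) = - (u - v) :> R by ring.
by have := Hr (m - y); rewrite /= !E !normrN mulrN mulNr => /(_ ys).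
Qed.

Lemma within_comp_continuous (R : realType) (A B : set R) (f phi : R -> R) :
  continuous phi -> (forall x, A x -> B (phi x)) -> {within B, continuous f} ->
  {within A, continuous (f \o phi)}.
Proof.
move=> cphi AB /subspace_continuousP Hf; apply/subspace_continuousP => x Ax.
apply: (@cvg_comp _ _ _ phi f _ (within B (nbhs (phi x)))); last first.
  exact: Hf (AB _ Ax).
move=> U /= HU.
change (nbhs x [set y | A y -> U (phi y)]).
have : nbhs x (phi @^-1` [set y | B y -> U y]) := cphi x _ HU.
by apply: filterS => y /= Hy Ay; exact/Hy/AB.
Qed.

Lemma left_cvg_within (R : realType) (f : R -> R) (a b : R) :
  a < b -> {within `[a, b], continuous f} -> f s @[s --> b^'-] --> f b.
Proof. by move=> ab /(continuous_within_itvP _ ab)[]. Qed.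

(* The function Z(s) of the header is
   sym_smooth m h F f f1 s + sym_weight h s * (f2 (m + s) + f2 (m - s)),
   where F is a primitive of f; at s = h the weight vanishes. *)
Definition sym_smooth {R : realType} (m h : R) (F f f1 : R -> R) (s : R) : R :=
  s * (f (m + s) + f (m - s)) - (F (m + s) - F (m - s))
  + (h ^+ 2 - 3 * s ^+ 2) / 6 * (f1 (m + s) - f1 (m - s)).

Definition sym_weight {R : realType} (h s : R) : R := - ((h ^+ 2 - s ^+ 2) * s / 6).

Lemma is_derive_sym_weight (R : realType) (h s : R) :
  is_derive s 1 (sym_weight h) (- ((h ^+ 2 - 3 * s ^+ 2) / 6)).
Proof.
have -> : sym_weight h = (fun t => 6^-1 * (t * (t * t)) - (h ^+ 2 / 6) * t).
  by apply/funext => t; rewrite /sym_weight; field.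
by apply: is_derive_eq; rewrite -![_ *: _]/(_ * _); field.
Qed.

(** The values of f cancel against the derivative of F, and s (f1 (m + s) - f1 (m - s)) against the
    derivative -s of (h^2 - 3 s^2) / 6. The remaining coefficient is opposite to the derivative of
    [sym_weight], as [slope_le_cancel] needs. *)
Lemma is_derive_sym_smooth (R : realType) (m h s : R) (F f f1 f2 : R -> R) :
  (forall x, x = m + s \/ x = m - s ->
     [/\ is_derive x 1 F (f x), is_derive x 1 f (f1 x) & is_derive x 1 f1 (f2 x)]) ->
  is_derive s 1 (sym_smooth m h F f f1)
    ((h ^+ 2 - 3 * s ^+ 2) / 6 * (f2 (m + s) + f2 (m - s))).
Proof.
move=> H; have [Fp fp f1p] := H _ (or_introl erefl).
have [Fm fm f1m] := H _ (or_intror erefl).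
have -> : sym_smooth m h F f f1 = (fun t =>
    t * (f (m + t) + f (m - t)) - (F (m + t) - F (m - t))
    + (h ^+ 2 / 6 - 2^-1 * (t * t)) * (f1 (m + t) - f1 (m - t))).
  by apply/funext => t; rewrite /sym_smooth; field.
have := is_derive_shift_comp fp; have := is_derive_reflect_comp fm.
have := is_derive_shift_comp Fp; have := is_derive_reflect_comp Fm.
have := is_derive_shift_comp f1p; have := is_derive_reflect_comp f1m => *.
by apply: is_derive_eq; rewrite -![_ *: _]/(_ * _); field.
Qed.

Lemma slope_le_sym (R : realType) (m h s : R) (F f f1 f2 G : R -> R) :
  (forall x, x = m + s \/ x = m - s ->
     [/\ is_derive x 1 F (f x), is_derive x 1 f (f1 x), is_derive x 1 f1 (f2 x),
         slope_le f2 x (G x) & 0 <= G x]) ->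
  slope_le (fun t => sym_smooth m h F f f1 t
                     + sym_weight h t * (f2 (m + t) + f2 (m - t))) s
    (`|sym_weight h s| * (G (m + s) + G (m - s))).
Proof.
move=> H; have [_ _ _ Gp Gp0] := H _ (or_introl erefl).
have [_ _ _ Gm Gm0] := H _ (or_intror erefl).
have dD := @is_derive_sym_smooth _ m h s F f f1 f2.
apply: (@slope_le_cancel _ (sym_smooth m h F f f1) _
  (fun t => f2 (m + t) + f2 (m - t)) _ _ _ _ _ (dD _) (is_derive_sym_weight h s)).
- exact: addr_ge0.
- by move=> x /H[].
- exact: slope_le_D (slope_le_shift Gp) (slope_le_reflect Gm).
- by rewrite mulNr addrN.
Qed.

Lemma sym_smooth_left_cvg (R : realType) (m h : R) (F f f1 : R -> R) :
  0 < h -> {within `[m - h, m + h], continuous F} ->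
  {within `[m - h, m + h], continuous f} ->
  {within `[m - h, m + h], continuous f1} ->
  sym_smooth m h F f f1 s @[s --> h^'-] --> sym_smooth m h F f f1 h.
Proof.
move=> h0 cF cf cf1.
have pm (g : R -> R) : {within `[m - h, m + h], continuous g} ->
    g (m + s) @[s --> h^'-] --> g (m + h) /\
    g (m - s) @[s --> h^'-] --> g (m - h).
  move=> cg; split.
  - suff c : {within `[0, h], continuous (g \o (fun s => m + s))}.
      exact: (left_cvg_within h0 c).
    apply: within_comp_continuous cg.
      by move=> x; apply: continuousD => //; exact: cst_continuous.
    by move=> x /=; rewrite !in_itv/=; lra.
  - suff c : {within `[0, h], continuous (g \o (fun s => m - s))}.
      exact: (left_cvg_within h0 c).
    apply: within_comp_continuous cg.
      by move=> x; apply: continuousB => //; exact: cst_continuous.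
    by move=> x /=; rewrite !in_itv/=; lra.
have [Fp Fm] := pm _ cF; have [fp fm] := pm _ cf; have [f1p f1m] := pm _ cf1.
have idh : s @[s --> h^'-] --> h by apply: cvg_at_left_filter; exact: cvg_id.
apply: cvgD.
  by apply: cvgB; [apply: cvgM => //; exact: cvgD|exact: cvgB].
apply: cvgM; last exact: cvgB.
apply: cvgMl; apply: cvgB; first exact: cvg_cst.
by apply: cvgMr; apply: cvgM.
Qed.

(** Comparison with V bounds Z on the open interval from 0 to h. The bound passes to s = h through
    the left continuity of the smooth part. *)
Lemma sym_smooth_le (R : realType) (m h C : R) (F f f1 f2 G V v : R -> R) :
  0 < h ->
  (forall x, m - h < x < m + h ->
     [/\ is_derive x 1 F (f x), is_derive x 1 f (f1 x), is_derive x 1 f1 (f2 x),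
         slope_le f2 x (G x) & 0 <= G x]) ->
  {within `[m - h, m + h], continuous F} ->
  {within `[m - h, m + h], continuous f} ->
  {within `[m - h, m + h], continuous f1} ->
  (forall s, 0 < s < h -> is_derive s 1 V (v s)) ->
  (forall s, 0 < s < h ->
     (h ^+ 2 - s ^+ 2) * s / 6 * (G (m + s) + G (m - s)) <= v s) ->
  (forall s, 0 < s < h -> 0 <= V s <= C) ->
  `|sym_smooth m h F f f1 h| <= C.
Proof.
move=> h0 H cF cf cf1 dV vG VC.
pose D := sym_smooth m h F f f1; pose psi s := f2 (m + s) + f2 (m - s).
pose Z s := D s + sym_weight h s * psi s.
have Hpm s : - h < s < h -> forall x, x = m + s \/ x = m - s -> m - h < x < m + h.
  by move=> sh x [->|->]; lra.
have slopeZ s : - h < s < h -> slope_le Z s (`|sym_weight h s| * (G (m + s) + G (m - s))).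
  by move=> /Hpm sh; apply: slope_le_sym => x /sh; exact: H.
have Z0 : Z 0 = 0.
  rewrite /Z /D /sym_smooth /sym_weight !addr0 !subr0 subrr !mul0r.
  by rewrite !(subrr, mulr0, oppr0, add0r, mul0r).
have ZC s : 0 < s < h -> `|Z s| <= C.
  move=> /andP[s0 sh]; apply/ler_addgt0Pr => e e0.
  (* V is controlled only for 0 < s < h, so the comparison starts at a small c > 0. The weight
     vanishes at 0, hence Z has slope 0 there and Z c is negligible. *)
  have [r /= r0 Hr] : \forall c \near (0 : R), `|Z c| <= 1 * `|c|.
    have h00 : - h < 0 < h by rewrite oppr_lt0 h0.
    have w0 : sym_weight h 0 = 0 by rewrite /sym_weight mulr0 mul0r oppr0.
    apply: filterS (slopeZ 0 h00 1 ltr01) => c.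
    by rewrite w0 normr0 mul0r add0r Z0 !subr0.
  pose c := Num.min (r / 2) (Num.min (s / 2) e).
  have c0 : 0 < c by rewrite !lt_min !divr_gt0.
  have cr : c <= r / 2 by rewrite ge_min lexx.
  have cs : c <= s / 2 by rewrite !ge_min lexx !orbT.
  have ce : c <= e by rewrite !ge_min lexx !orbT.
  have Zc : `|Z c| <= c.
    have := Hr c; rewrite /= sub0r normrN mul1r gtr0_norm//; apply; lra.
  have inc : `|Z s - Z c| <= V s - V c.
    apply: (@slope_le_increment _ _ _ v); first by lra.
      move=> t /andP[ct ts]; have th : 0 < t < h by lra.
      apply: slope_le_mono (vG t th) _.
      have -> : (h ^+ 2 - t ^+ 2) * t / 6 = `|sym_weight h t|.
        by rewrite normrN ger0_norm// divr_ge0// mulr_ge0//; [nra|lra].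
      by apply: slopeZ; lra.
    by move=> t /andP[ct ts]; apply: dV; lra.
  have := ler_normD (Z s - Z c) (Z c); rewrite subrK.
  have Vs : 0 <= V s <= C by apply: VC; lra.
  have Vc : 0 <= V c <= C by apply: VC; lra.
  lra.
pose dpsi s := f1 (m + s) - f1 (m - s).
have cdpsi : {within `[0, h], continuous dpsi}.
  have cp : {within `[0, h], continuous (f1 \o (fun s : R => m + s))}.
    apply: within_comp_continuous cf1.
      by move=> x; apply: continuousD => //; exact: cst_continuous.
    by move=> x /=; rewrite !in_itv/=; lra.
  have cm : {within `[0, h], continuous (f1 \o (fun s : R => m - s))}.
    apply: within_comp_continuous cf1.
      by move=> x; apply: continuousB => //; exact: cst_continuous.
    by move=> x /=; rewrite !in_itv/=; lra.
  by move=> x; apply: continuousB; [exact: cp|exact: cm].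
have dpsi_left := left_cvg_within h0 cdpsi.
have D_left := sym_smooth_left_cvg h0 cF cf cf1.
(* f2 (m + s) + f2 (m - s) need not be bounded as s tends to h; the mean value
   theorem makes its product with h - s small along a sequence. *)
suff : forall e, 0 < e -> `|D h| <= C + e * (1 + h ^+ 2).
  move=> K; apply/ler_addgt0Pr => e e0.
  have h2 : 0 < 1 + h ^+ 2 by rewrite ltr_wpDr// sqr_ge0.
  by have := K (e / (1 + h ^+ 2)); rewrite divfK ?gt_eqF//; apply; rewrite divr_gt0.
move=> e e0.
have [r /= r0 Hr] : \forall s \near h^'-, `|D h - D s| <= e /\ `|dpsi h - dpsi s| <= e.
  near=> s; split; near: s.
    by move/cvgrPdist_le : D_left; exact.
  by move/cvgrPdist_le : dpsi_left; exact.
(* The first bound keeps s0 within r of h, the second keeps it positive. *)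
pose s0 := Num.max (h - r / 2) (h / 2).
have s0h : s0 < h by rewrite gt_max; apply/andP; split; lra.
have s0r : h - r / 2 <= s0 by rewrite le_max lexx.
have s00 : h / 2 <= s0 by rewrite le_max lexx orbT.
have [xi xis Hxi] : exists2 c, c \in `]s0, h[ & dpsi h - dpsi s0 = psi c * (h - s0).
  apply: MVT => // [x|].
    rewrite in_itv/= => xs; have xh : - h < x < h by lra.
    have [_ _ /is_derive_shift_comp dp _ _] := H _ (Hpm _ xh _ (or_introl erefl)).
    have [_ _ /is_derive_reflect_comp dm _ _] := H _ (Hpm _ xh _ (or_intror erefl)).
    by rewrite /psi -[f2 (m - x)]opprK; exact: is_deriveB.
  apply: continuous_subspaceW cdpsi => x /=; rewrite !in_itv/=; lra.
have {}xis : s0 < xi < h by move: xis; rewrite in_itv.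
have [Dxi _] : `|D h - D xi| <= e /\ `|dpsi h - dpsi xi| <= e.
  by apply: Hr; [rewrite /= ger0_norm; lra|lra].
have [_ psi0] : `|D h - D s0| <= e /\ `|dpsi h - dpsi s0| <= e.
  by apply: Hr; [rewrite /= ger0_norm; lra|lra].
have Zxi : `|Z xi| <= C by apply: ZC; lra.
(* Since s0 < xi, |psi xi| (h - xi) is at most |psi xi| (h - s0), an increment of [dpsi] bounded by
   e. The other factor (h + xi) xi / 6 of the weight is at most h^2. *)
have wpsi : `|sym_weight h xi * psi xi| <= e * h ^+ 2.
  have : `|psi xi| * (h - xi) <= e.
    apply: le_trans psi0; rewrite Hxi normrM (@ger0_norm _ (h - s0)); last by lra.
    by rewrite ler_wpM2l//; lra.
  have -> : sym_weight h xi = - ((h + xi) * xi / 6 * (h - xi)).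
    by rewrite /sym_weight; field.
  rewrite mulNr normrN normrM (@ger0_norm _ (_ * (h - xi))); last first.
    by rewrite mulr_ge0//; nra.
  move=> Hp.
  have : (h + xi) * xi / 6 * (`|psi xi| * (h - xi)) <= h ^+ 2 * e.
    apply: ler_pM => //; first by rewrite divr_ge0// mulr_ge0//; lra.
      by rewrite mulr_ge0//; lra.
    by rewrite ler_pdivrMr//; nra.
  lra.
have := ler_normD (D h - D xi + Z xi) (- (sym_weight h xi * psi xi)).
have := ler_normD (D h - D xi) (Z xi).
have -> : D h - D xi + Z xi - sym_weight h xi * psi xi = D h by rewrite /Z; ring.
by rewrite normrN; lra.
Unshelve. all: by end_near. Qed.

(** * Primitives and the incomplete Beta function *)

Lemma continuous_primitive (R : realType) (f : R -> R) (a b : R) :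
  a < b -> {within `[a, b], continuous f} ->
  let F x := \int[@lebesgue_measure R]_(t in [set` `[a, x]]) f t in
  [/\ F a = 0, {within `[a, b], continuous F} &
      forall x, a < x < b -> is_derive x 1 F (f x)].
Proof.
move=> ab cf F.
have intf : (@lebesgue_measure R).-integrable `[a, b] (EFin \o f).
  by apply: continuous_compact_integrable => //; exact: segment_compact.
split; first by rewrite /F set_itv1 Rintegral_set1.
  exact: parameterized_integral_continuous (ltW ab) intf.
move=> x /andP[ax xb]; have xab : x \in `]a, b[ by rewrite in_itv/= ax.
have [dF Fx] := continuous_FTC1_closed xb intf ax (within_continuous_continuous ab cf xab).
by split; [exact: dF|rewrite -derive1E].
Qed.

Lemma within_powR_continuous (R : realType) (r : R) :
  0 < r -> {within `[0, 1], continuous (fun t : R => t `^ r)}.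
Proof.
move=> r0; have pc (t : R) : 0 < t -> {for t, continuous (fun t : R => t `^ r)}.
  move=> t0; apply: differentiable_continuous; apply/derivable1_diffP.
  by apply: derivable_powR; rewrite in_itv/= t0.
apply/continuous_within_itvP; first exact: ltr01.
split.
- by move=> t; rewrite in_itv/= => /andP[t0 _]; exact: pc.
- by rewrite powR0 ?gt_eqF//; exact: powR_cvg0.
- by apply: cvg_at_left_filter; exact: pc ltr01.
Qed.

(** B is the incomplete Beta function. Its integrand is positive inside the unit interval, so the
    mean value theorem gives strict growth, hence positivity of the full integral. *)
Lemma euler_beta_primitive (R : realType) (q : R) : 1 < q ->
  let b t := t `^ (q - 1) * (1 - t) `^ q in
  exists B : R -> R, [/\ B 1 = euler_beta q (q + 1), 0 < euler_beta q (q + 1),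
    forall t : R, 0 < t < 1 -> is_derive t 1 B (b t),
    forall t : R, 0 < t < 1 -> 0 <= B t <= B 1 &
    forall t u : R, 0 < t -> t <= u -> u < 1 -> B t <= B u].
Proof.
move=> q1 b.
have cb : {within `[0, 1], continuous b}.
  have c1 : {within `[0, 1], continuous (fun t : R => t `^ (q - 1))}.
    by apply: within_powR_continuous; rewrite subr_gt0.
  have c2 : {within `[0, 1], continuous ((fun t : R => t `^ q) \o (fun t : R => 1 - t))}.
    apply: (@within_comp_continuous _ _ `[0, 1]).
    - by move=> x; apply: continuousB => //; exact: cst_continuous.
    - by move=> x /=; rewrite !in_itv/=; lra.
    - by apply: within_powR_continuous; exact: lt_trans q1.
  by move=> x; exact: (continuousM (c1 x) (c2 x)).
pose B x := \int[@lebesgue_measure R]_(t in [set` `[0, x]]) b t.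
have [B0 cB dB] : [/\ B 0 = 0, {within `[0, 1], continuous B} &
    forall x : R, 0 < x < 1 -> is_derive x 1 B (b x)] := continuous_primitive ltr01 cb.
have B1 : B 1 = euler_beta q (q + 1) by rewrite /euler_beta addrK.
clearbody B.
have mono t u : 0 <= t -> t < u -> u <= 1 -> exists2 d, 0 < d & B u = B t + d.
  move=> t0 tu u1; have [x|| x xtu Bx] := @MVT _ B b t u tu.
  - by rewrite in_itv/= => xtu; apply: dB; lra.
  - by apply: continuous_subspaceW cB => x /=; rewrite !in_itv/=; lra.
  - have {}xtu : t < x < u by move: xtu; rewrite in_itv.
    exists (b x * (u - t)); last by rewrite -Bx; ring.
    by rewrite mulr_gt0 ?subr_gt0// /b mulr_gt0// powR_gt0; lra.
exists B; split=> //.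
- by have [d d0] := mono 0 1 (lexx _) ltr01 (lexx _); rewrite -B1 B0 add0r => ->.
- move=> t /andP[t0 t1].
  have [d d0 ->] := mono t 1 (ltW t0) t1 (lexx _).
  have [d' d'0 ->] := mono 0 t (lexx _) t0 (ltW t1).
  by rewrite B0; apply/andP; split; lra.
- move=> t u t0; rewrite le_eqVlt => /predU1P[->//|tu] u1.
  by have [d d0 ->] := mono t u (ltW t0) tu (ltW u1); rewrite lerDl ltW.
Qed.

(** * Young's inequality and the Godunova-Levin majorant *)

(* Young's inequality with the weights for which integrating it yields Hölder's
   inequality. *)
Lemma weighted_young (R : realType) (p q u w N T : R) :
  0 < p -> 0 < q -> p^-1 + q^-1 = 1 -> 0 <= u -> 0 <= w -> 0 < N -> 0 < T ->
  u * w `^ q^-1 <=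
  T `^ q^-1 / N `^ p^-1 * (N * u `^ p / p + w / (q * T)).
Proof.
move=> p0 q0 pq u0 w0 N0 T0.
have NX : 0 < N `^ p^-1 by rewrite powR_gt0.
have YT : 0 < T `^ q^-1 by rewrite powR_gt0.
(* The p-th and q-th powers of these two factors are N u^p and w / T. *)
have := @conjugate_powR _ (u * N `^ p^-1) ((w / T) `^ q^-1) p q.
rewrite powR_ge0 mulr_ge0 ?powR_ge0// => /(_ isT isT p0 q0 pq).
rewrite (@powRM _ u) ?powR_ge0// -!powRrM !mulVf ?gt_eqF//.
rewrite !powRr1 ?divr_ge0 ?(ltW T0) ?(ltW N0)//.
have E : w `^ q^-1 = (w / T) `^ q^-1 * T `^ q^-1.
  by rewrite -powRM ?divr_ge0 ?(ltW T0)// divfK// gt_eqF.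
rewrite E => H.
have -> : u * ((w / T) `^ q^-1 * T `^ q^-1) =
   T `^ q^-1 / N `^ p^-1 * (u * N `^ p^-1 * (w / T) `^ q^-1).
  by field; rewrite gt_eqF.
rewrite ler_pM2l ?divr_gt0//; apply: le_trans H _.
by rewrite (mulrC N) lerD2l -mulrA -invfM (mulrC T).
Qed.

(* The bound on |f'''| at x = t a + (1 - t) b, where t = (b - x) / (b - a), with
   A = |f'''(a)|^q and B = |f'''(b)|^q. *)
Definition gl_majorant {R : realType} (a b A B q x : R) : R :=
  (A / ((b - x) / (b - a)) + B / ((x - a) / (b - a))) `^ q^-1.

Lemma godunova_levin_le (R : realType) (I : set R) (g : R -> R) (a b q x : R) :
  godunova_levin I (fun x => `|g x| `^ q) -> I a -> I b -> 0 < q -> a < x < b ->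
  `|g x| <= gl_majorant a b (`|g a| `^ q) (`|g b| `^ q) q x.
Proof.
move=> [_ gl] Ia Ib q0 /andP[ax xb]; have ab : 0 < b - a by lra.
have t01 : 0 < (b - x) / (b - a) < 1.
  apply/andP; split; first by rewrite divr_gt0//; lra.
  by rewrite ltr_pdivrMr//; lra.
have := gl a b _ Ia Ib t01.
have -> : (b - x) / (b - a) * a + (1 - (b - x) / (b - a)) * b = x.
  by field; rewrite gt_eqF.
have -> : 1 - (b - x) / (b - a) = (x - a) / (b - a) by field; rewrite gt_eqF.
move=> H; rewrite /gl_majorant.
have -> : `|g x| = (`|g x| `^ q) `^ q^-1.
  by rewrite -powRrM mulfV ?gt_eqF// powRr1.
apply: ge0_ler_powR => //; rewrite ?nnegrE ?invr_ge0 ?powR_ge0 ?(ltW q0)//.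
exact: le_trans (powR_ge0 _ _) H.
Qed.

Lemma gl_majorant_continuous (R : realType) (a b A B q x : R) :
  0 <= A -> 0 <= B -> 0 < q -> a < x < b ->
  {for x, continuous (gl_majorant a b A B q)}.
Proof.
move=> A0 B0 q0 /andP[ax xb].
have ab : 0 < b - a by lra.
(* The case A = B = 0 is separate because the power 1/q is differentiable only at a positive
   argument. *)
have [AB|AB] := leP (A + B) 0.
  have -> : A = 0 by lra.
  have -> : B = 0 by lra.
  rewrite (_ : gl_majorant _ _ _ _ _ = cst 0); first exact: cst_continuous.
  by apply/funext => y; rewrite /gl_majorant !mul0r addr0 powR0// invr_eq0 gt_eqF.
pose k y : R := A / ((b - y) / (b - a)) + B / ((y - a) / (b - a)).
have t1 : 0 < (b - x) / (b - a) by rewrite divr_gt0//; lra.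
have t2 : 0 < (x - a) / (b - a) by rewrite divr_gt0//; lra.
have k0 : 0 < k x.
  rewrite /k; have [A1|A1] := ltP 0 A.
    by apply: ltr_pwDl; [exact: divr_gt0|apply: divr_ge0 => //; exact: ltW].
  apply: ltr_wpDl; first by apply: divr_ge0 => //; exact: ltW.
  by apply: divr_gt0 => //; lra.
have ck : {for x, continuous k}.
  apply: cvgD; apply: cvgMr; (apply: cvgV; first exact: lt0r_neq0);
    apply: cvgMl.
  - by apply: cvgB; [exact: cvg_cst|exact: cvg_id].
  - by apply: cvgB; [exact: cvg_id|exact: cvg_cst].
have cp : {for k x, continuous (fun t : R => t `^ q^-1)}.
  apply: differentiable_continuous; apply/derivable1_diffP.
  by apply: derivable_powR; rewrite in_itv/= k0.
exact: (continuous_comp ck cp).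
Qed.

(** Moved under the root, t (1 - t) becomes its q-th power and absorbs both denominators; this
    produces the Beta integrand and its reflection. *)
Lemma gl_majorant_weight (R : realType) (A B q t : R) :
  0 <= A -> 0 <= B -> 1 < q -> 0 < t < 1 ->
  t * (1 - t) * (A / t + B / (1 - t)) `^ q^-1 =
  (A * (t `^ (q - 1) * (1 - t) `^ q) + B * ((1 - t) `^ (q - 1) * t `^ q)) `^ q^-1.
Proof.
move=> A0 B0 q1 /andP[t0 t1]; have q0 : 0 < q by lra.
have t'0 : 0 < 1 - t by lra.
have tt0 : 0 <= t * (1 - t) by rewrite mulr_ge0// ltW.
have {1}-> : t * (1 - t) = ((t * (1 - t)) `^ q) `^ q^-1.
  by rewrite -powRrM mulfV ?gt_eqF// powRr1.
rewrite -powRM ?powR_ge0//; last by rewrite addr_ge0// divr_ge0// ltW.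
congr (_ `^ _); rewrite powRM ?(ltW t0) ?(ltW t'0)//.
rewrite -[in LHS](mulr_powRB1 (ltW t0) q0) -[in LHS](mulr_powRB1 (ltW t'0) q0).
rewrite -[in RHS](mulr_powRB1 (ltW t0) q0) -[in RHS](mulr_powRB1 (ltW t'0) q0).
by field; rewrite !gt_eqF.
Qed.

Lemma gl_majorant_young (R : realType) (m h A B p q s beta : R) :
  let t := (h - s) / (2 * h) in let t' := (h + s) / (2 * h) in
  0 <= A -> 0 <= B -> 0 < p -> 1 < q -> p^-1 + q^-1 = 1 -> 0 < beta -> 0 < s < h ->
  (h ^+ 2 - s ^+ 2) * s / 6
    * (gl_majorant (m - h) (m + h) A B q (m + s)
       + gl_majorant (m - h) (m + h) A B q (m - s)) <=
  2 * h ^+ 3 / 3 * (((A + B) * beta) `^ q^-1 / (p + 1) `^ p^-1)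
    * (2 * (p + 1) / p * (s / h) `^ p
       + (t `^ (q - 1) * (1 - t) `^ q + t' `^ (q - 1) * (1 - t') `^ q) / (q * beta)).
Proof.
move=> t t' A0 B0 p0 q1 pq beta0 /andP[s0 sh].
have q0 : 0 < q by lra.
have h0 : 0 < h by lra.
have h20 : 0 < 2 * h by lra.
have t0 : 0 < t < 1.
  by rewrite /t divr_gt0 ?subr_gt0//= ltr_pdivrMr//; lra.
have t'0 : 0 < t' < 1.
  by rewrite /t' divr_gt0 ?addr_gt0//= ltr_pdivrMr//; lra.
have tt' : 1 - t = t' by rewrite /t /t'; field; rewrite gt_eqF.
have t't : 1 - t' = t by rewrite /t /t'; field; rewrite gt_eqF.
have w1 := gl_majorant_weight A0 B0 q1 t0; have w2 := gl_majorant_weight A0 B0 q1 t'0.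
rewrite tt' in w1; rewrite t't in w2; rewrite tt' t't.
have bah : m + h - (m - h) = 2 * h by ring.
have e1 : m + h - (m + s) = h - s by ring.
have e2 : m + s - (m - h) = h + s by ring.
have e3 : m + h - (m - s) = h + s by ring.
have e4 : m - s - (m - h) = h - s by ring.
rewrite /gl_majorant bah e1 e2 e3 e4 -/t -/t'.
set x1 := A * _ + B * (t' `^ _ * _) in w1; set x2 := A * _ + B * (t `^ _ * _) in w2.
have b1 : 0 <= t `^ (q - 1) * t' `^ q by rewrite mulr_ge0 ?powR_ge0.
have b2 : 0 <= t' `^ (q - 1) * t `^ q by rewrite mulr_ge0 ?powR_ge0.
have x10 : 0 <= x1 by apply: addr_ge0; apply: mulr_ge0.
have x20 : 0 <= x2 by apply: addr_ge0; apply: mulr_ge0.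
(* Here h - s = 2 h t and h + s = 2 h t', so the kernel equals (2 h^3 / 3) (s / h) t t'. *)
have -> : (h ^+ 2 - s ^+ 2) * s / 6
      * ((A / t + B / t') `^ q^-1 + (A / t' + B / t) `^ q^-1) =
    2 * h ^+ 3 / 3 * (s / h * x1 `^ q^-1 + s / h * x2 `^ q^-1).
  by rewrite -w1 -w2 /t /t'; field; rewrite gt_eqF.
rewrite -(mulrA (2 * h ^+ 3 / 3)) ler_pM2l; last by rewrite divr_gt0 ?mulr_gt0 ?exprn_gt0.
(* If A = B = 0, the normaliser (A + B) beta is zero and Young's inequality cannot be weighted by
   it, but both sides vanish. *)
have [AB|AB] := leP (A + B) 0.
  have A1 : A = 0 by apply/le_anti; rewrite A0 andbT (le_trans _ AB)// lerDl.
  have B1 : B = 0 by apply/le_anti; rewrite B0 andbT (le_trans _ AB)// lerDr.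
  rewrite /x1 /x2 A1 B1 !mul0r !addr0 mul0r powR0; last by rewrite invr_eq0 gt_eqF.
  by rewrite !(mul0r, mulr0) addr0.
have T0 : 0 < (A + B) * beta by rewrite mulr_gt0.
have sh0 : 0 <= s / h by rewrite divr_ge0// ltW.
have p10 : 0 < p + 1 by rewrite addr_gt0.
(* The weights are normalising: (p + 1) u^p has integral 1 over the unit interval, and (A + B) beta
   is the integral of x1 over t in it when beta is the Beta value. Adding the two bounds lets A + B
   cancel. *)
have := weighted_young p0 q0 pq sh0 x10 p10 T0.
have := weighted_young p0 q0 pq sh0 x20 p10 T0.
move=> y1 y2; apply: le_trans (lerD y2 y1) _.
rewrite -mulrDr le_eqVlt; apply/orP; left; apply/eqP; congr (_ * _).
by rewrite /x1 /x2; field; rewrite !gt_eqF.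
Qed.

(** As functions of s, t and t' have slopes -1/(2h) and 1/(2h), so the difference of the values of B
    differentiates to the sum of the two integrands. *)
Lemma is_derive_gl_primitive (R : realType) (h p q s beta c : R) (B : R -> R) :
  let b t := t `^ (q - 1) * (1 - t) `^ q in
  let t := (h - s) / (2 * h) in let t' := (h + s) / (2 * h) in
  0 < p -> 0 < q -> 0 < beta -> 0 < s < h ->
  (forall t : R, 0 < t < 1 -> is_derive t 1 B (b t)) ->
  is_derive s 1 (fun s : R => c * (2 * h / p * (s / h) `^ (p + 1)
      + 2 * h / (q * beta) * (B ((h + s) / (2 * h)) - B ((h - s) / (2 * h)))))
    (c * (2 * (p + 1) / p * (s / h) `^ p + (b t + b t') / (q * beta))).
Proof.
move=> b t t' p0 q0 beta0 /andP[s0 sh] dB.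
have h0 : 0 < h by lra.
have h20 : 0 < 2 * h by lra.
have t0 : 0 < t < 1.
  by rewrite /t divr_gt0 ?subr_gt0//= ltr_pdivrMr//; lra.
have t'0 : 0 < t' < 1.
  by rewrite /t' divr_gt0 ?addr_gt0//= ltr_pdivrMr//; lra.
have d1 : is_derive s 1 (fun s : R => (s / h) `^ (p + 1)) ((p + 1) * (s / h) `^ p / h).
  have dl : is_derive s 1 (fun s : R => s / h) h^-1.
    by apply: is_derive_eq; rewrite -![_ *: _]/(_ * _); field; rewrite gt_eqF.
  have dp : is_derive (s / h) 1 (fun x : R => x `^ (p + 1)) ((p + 1) * (s / h) `^ p).
    have := @is_derive1_powR R (p + 1) (s / h); rewrite addrK; apply.
    by rewrite divr_gt0.
  exact: (@is_derive1_comp R (fun x => x `^ (p + 1)) (fun s => s / h) _ _ _ dp dl).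
have d2 : is_derive s 1 (fun s : R => B ((h + s) / (2 * h))) (b t' / (2 * h)).
  have dl : is_derive s 1 (fun s : R => (h + s) / (2 * h)) (2 * h)^-1.
    by apply: is_derive_eq; rewrite -![_ *: _]/(_ * _); field; rewrite gt_eqF.
  exact: (@is_derive1_comp R B (fun s => (h + s) / (2 * h)) _ _ _ (dB _ t'0) dl).
have d3 : is_derive s 1 (fun s : R => B ((h - s) / (2 * h))) (b t * - (2 * h)^-1).
  have dl : is_derive s 1 (fun s : R => (h - s) / (2 * h)) (- (2 * h)^-1).
    by apply: is_derive_eq; rewrite -![_ *: _]/(_ * _); field; rewrite gt_eqF.
  exact: (@is_derive1_comp R B (fun s => (h - s) / (2 * h)) _ _ _ (dB _ t0) dl).
apply: is_derive_eq; rewrite -![_ *: _]/(_ * _); field.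
by rewrite !gt_eqF.
Qed.

(** * Reduction of the inequality to the bound on Z(h) *)

(* f1, f2, f3 stand for f', f'', f''' on I. Absolute continuity of f'' gives
   f''' almost everywhere only, so f3 : I -> R is any function which is almost
   everywhere the derivative of f''. *)
Theorem theorem4 (R : realType) (I : set R) (f f1 f2 f3 : R -> R)
    (a b p q : R)
    (I_itv : is_interval I)
    (f1_deriv : forall x, I x -> has_derivative_in I f x (f1 x))
    (f2_deriv : forall x, I x -> has_derivative_in I f1 x (f2 x))
    (f2_ac : locally_absolutely_continuous_on (interior I) f2)
    (f3_deriv : {ae @lebesgue_measure R, forall x,
        interior I x -> has_derivative_in I f2 x (f3 x)})
    (aI : I a) (bI : I b) (ab : a < b)
    (f3_int : lebesgue_integrable a b f3)
    (q_gt1 : 1 < q) (pq : p^-1 + q^-1 = 1)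
    (f3_Q : godunova_levin I (fun x => `|f3 x| `^ q)) :
  `| (f a + f b) / 2
     - (b - a)^-1 * (\int[@lebesgue_measure R]_(x in [set` `[a, b]]) f x)
     - (b - a) / 12 * (f1 b - f1 a) |
  <= (b - a) ^+ 3 / 12
     * ((euler_beta q (q + 1)) `^ (q^-1) / (p + 1) `^ (p^-1))
     * (`|f3 a| `^ q + `|f3 b| `^ q) `^ (q^-1).
Proof.
have q0 : 0 < q by exact: lt_trans q_gt1.
have p0 : 0 < p.
  have : 0 < p^-1 by rewrite -(addrK q^-1 p^-1) pq subr_gt0 invf_lt1.
  by rewrite invr_gt0.
pose m := (a + b) / 2; pose h := (b - a) / 2.
have h0 : 0 < h by rewrite divr_gt0 ?subr_gt0.
have am : m - h = a by rewrite /m /h; field.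
have bm : m + h = b by rewrite /m /h; field.
pose A := `|f3 a| `^ q; pose B := `|f3 b| `^ q.
have A0 : 0 <= A by exact: powR_ge0.
have B0 : 0 <= B by exact: powR_ge0.
have abI : `[a, b] `<=` I.
  by move=> x /=; rewrite in_itv/= => /andP[ax xb]; apply: (I_itv a b) => //; apply/andP.
have abI0 : `]a, b[ `<=` interior I.
  rewrite -open_subsetE; last exact: interval_open.
  by apply: subset_trans abI; exact: subset_itv_oo_cc.
have intI x : a < x < b -> interior I x by move=> xab; apply: abI0; rewrite /= in_itv.
have cf := has_derivative_in_continuous abI f1_deriv.
have cf1 := has_derivative_in_continuous abI f2_deriv.
have [F0 cF dF] := continuous_primitive ab cf.
pose F x := \int[@lebesgue_measure R]_(t in [set` `[a, x]]) f t.
rewrite -/(F a) -/F in F0 cF dF.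
have [beta [beta1 beta0 dbeta beta_le beta_mono]] := euler_beta_primitive q_gt1.
set be := euler_beta q (q + 1) in beta1 beta0 *.
have slope x : a < x < b -> slope_le f2 x (gl_majorant a b A B q x).
  move=> xab; apply: (ac_slope_le _ _ xab).
  - move=> c d cd cdab; apply: f2_ac => //; exact: subset_trans cdab abI0.
  - apply: negligibleS f3_deriv => y /= Hy H; apply: Hy => yab.
    have := H (intI _ yab).
    move=> /(has_derivative_in_is_derive (intI _ yab)) /is_derive_slope_le.
    by apply: slope_le_mono; exact: (godunova_levin_le f3_Q).
  - exact: powR_ge0.
  - exact: gl_majorant_continuous.
pose K := ((A + B) * be) `^ q^-1 / (p + 1) `^ p^-1.
have K0 : 0 <= K by rewrite divr_ge0 ?powR_ge0.
have c0 : 0 <= 2 * h ^+ 3 / 3 * K.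
  by apply: mulr_ge0 => //; rewrite divr_ge0// mulr_ge0// exprn_ge0// ltW.
have main : `|sym_smooth m h F f f1 h| <= 2 * h ^+ 3 / 3 * K * (2 * h).
  pose t s := (h - s) / (2 * h); pose t' s := (h + s) / (2 * h).
  pose V s := 2 * h ^+ 3 / 3 * K * (2 * h / p * (s / h) `^ (p + 1)
                + 2 * h / (q * be) * (beta (t' s) - beta (t s))).
  pose v s := 2 * h ^+ 3 / 3 * K * (2 * (p + 1) / p * (s / h) `^ p
    + (t s `^ (q - 1) * (1 - t s) `^ q + t' s `^ (q - 1) * (1 - t' s) `^ q)
      / (q * be)).
  apply: (@sym_smooth_le R m h (2 * h ^+ 3 / 3 * K * (2 * h)) F f f1 f2
    (gl_majorant a b A B q) V v h0).
  - move=> x; rewrite am bm => xab; split.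
    + exact: dF.
    + exact: has_derivative_in_is_derive (intI _ xab)
        (f1_deriv _ (interior_subset (intI _ xab))).
    + exact: has_derivative_in_is_derive (intI _ xab)
        (f2_deriv _ (interior_subset (intI _ xab))).
    + exact: slope.
    + exact: powR_ge0.
  - by rewrite am bm.
  - by rewrite am bm.
  - by rewrite am bm.
  - move=> s sh; exact: (is_derive_gl_primitive (2 * h ^+ 3 / 3 * K) p0 q0 beta0 sh dbeta).
  - move=> s sh; have := gl_majorant_young m A0 B0 p0 q_gt1 pq beta0 sh.
    by rewrite am bm.
  - move=> s /andP[s0 sh] /=.
    have h20 : 0 < 2 * h by exact: mulr_gt0.
    have t1 : 0 < t s by apply: divr_gt0 => //; rewrite subr_gt0.
    have t2 : t' s < 1 by rewrite /t' ltr_pdivrMr// mul1r mulr2n mulrDl mul1r ltrD2l.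
    have t12 : t s <= t' s.
      by rewrite /t /t' ler_pM2r ?invr_gt0// lerD2l (le_trans _ (ltW s0))// oppr_le0 ltW.
    have mon := beta_mono _ _ t1 t12 t2.
    have t1' : 0 < t s < 1 by rewrite t1 (le_lt_trans t12).
    have t2' : 0 < t' s < 1 by rewrite t2 (lt_le_trans t1).
    have /andP[u0 _] := beta_le _ t1'; have /andP[_ u1] := beta_le _ t2'.
    rewrite beta1 in u1.
    have sp : (s / h) `^ (p + 1) <= 1.
      suff : (s / h) `^ (p + 1) <= 1 `^ (p + 1) by rewrite powR1.
      apply: ge0_ler_powR.
      - by rewrite addr_ge0// ltW.
      - by rewrite nnegrE divr_ge0// ltW.
      - by rewrite nnegrE.
      - by rewrite ler_pdivrMr// mul1r ltW.
    have hp0 : 0 <= 2 * h / p by rewrite divr_ge0// ltW.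
    have hq0 : 0 <= 2 * h / (q * be) by apply: divr_ge0; [|apply: mulr_ge0]; exact: ltW.
    apply/andP; split.
      by apply: mulr_ge0 => //; apply: addr_ge0; apply: mulr_ge0; rewrite ?powR_ge0 ?subr_ge0.
    (* The two terms of V are at most 2h/p and 2h/q times the common constant; conjugacy of p and q
       adds them to 2h. *)
    have E : 2 * h = 2 * h / p * 1 + 2 * h / (q * be) * be.
      rewrite -[LHS]mulr1 -[X in _ * X = _]pq; field.
      by rewrite !gt_eqF.
    rewrite ler_wpM2l// [leRHS]E; apply: lerD; apply: ler_wpM2l => //.
    by rewrite (le_trans _ u1)// lerBlDr lerDl.
have ba : b - a = 2 * h by rewrite /h; field.
have -> : (f a + f b) / 2 - (b - a)^-1 * F b - (b - a) / 12 * (f1 b - f1 a) =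
    (2 * h)^-1 * sym_smooth m h F f f1 h.
  by rewrite /sym_smooth am bm F0 ba; field; rewrite gt_eqF.
have h20 : 0 < 2 * h by rewrite mulr_gt0.
rewrite normrM ger0_norm ?invr_ge0 ?(ltW h20)// mulrC ler_pdivrMr//.
(* The constants agree because (b - a)^3 / 12 = 2 h^3 / 3. *)
apply: le_trans main _; rewrite ba -/A -/B /K powRM ?addr_ge0 ?(ltW beta0)//.
by rewrite le_eqVlt; apply/orP; left; apply/eqP; field; rewrite gt_eqF// powR_gt0// addr_gt0.
Qed.
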